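(* Let $W=W_{A_{n-1}}=S_n$. The action of $\eta_i$ on the $\mathbb H_W$-module $\mathcal C[\xi_1,\dots,\xi_n]$ is realized as the Dunkl operator $$\eta_i=t\,\partial_{\xi_i}+u\sum_{k\ne i}\frac1{\xi_i^2-\xi_k^2}\Big((\xi_i-\xi_k)s_{ik}-(\xi_i\tau_i-\xi_k\tau_k)\Big).$$
   Context: All algebras are over $\mathbb C$; $[a,b]_+=ab+ba$. $s_{ij}\in S_n$ is the transposition of $i,j$; $S_n$ permutes the indices of the $\xi_j$ and of the $\eta_j$, written $\xi_j\mapsto\xi_j^\sigma$. $\mathcal C[\xi_1,\dots,\xi_n]$ is the skew-polynomial algebra generated by $\xi_i$ with $\xi_i\xi_j=-\xi_j\xi_i$ for $i\ne j$ (no condition on $\xi_i^2$). Let $t,u\in\mathbb C$. The odd double affine Hecke algebra $\mathbb H_W$ of type $A_{n-1}$ is generated by $\xi_i,\eta_i$ ($1\le i\le n$) and $\mathbb C W$ subject to: $\eta_i\eta_j=-\eta_j\eta_i$, $\xi_i\xi_j=-\xi_j\xi_i$ ($i\ne j$); $\sigma\xi_j=\xi_j^\sigma\sigma$, $\sigma\eta_j=\eta_j^\sigma\sigma$ ($\sigma\in W$); $[\eta_i,\xi_j]_+=us_{ij}$ ($i\ne j$), $[\eta_i,\xi_i]_+=t+u\sum_{k\ne i}s_{ki}$. The module: let $\mathfrak h_\eta\subset\mathbb H_W$ be the subalgebra generated by the $\eta_i$ and $\mathbb C W$; let $V$ be the trivial one-dimensional $\mathbb C W$-module, extended to $\mathfrak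 h_\eta$ by letting each $\eta_i$ act by $0$. The induced module $\mathrm{Ind}_{\mathfrak h_\eta}^{\mathbb H_W}V$ is identified with $\mathcal C[\xi_1,\dots,\xi_n]$; here $\xi_i$ acts by left multiplication and $\sigma\in W$ by the automorphism $f\mapsto f^\sigma$. In the formula: $s_{ik}$ denotes the algebra automorphism of $\mathcal C[\xi_1,\dots,\xi_n]$ exchanging $\xi_i$ and $\xi_k$; $\tau_i$ denotes the automorphism $\xi_i\mapsto-\xi_i$, $\xi_j\mapsto\xi_j$ ($j\ne i$); $\xi_i$ denotes left multiplication; $\xi_i^2-\xi_k^2$ is central in $\mathcal C[\xi_1,\dots,\xi_n]$, and division by it is applied to the result (which is divisible by it). $\partial_{\xi_i}$ is the super derivation with $\partial_{\xi_i}(\xi_j)=\delta_{ij}$ and $\partial_{\xi_i}(\xi_{a_1}\cdots\xi_{a_l})=\sum_k(-1)^{k-1}\xi_{a_1}\cdots\xi_{a_{k-1}}\partial_{\xi_i}(\xi_{a_k})\xi_{a_{k+1}}\cdots\xi_{a_l}$. *)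

(* Defs.v *)
(* MathComp, with classical reasoning (boolp) used to form quotients. *)
From HB Require Import structures.
From mathcomp Require Import all_boot all_order all_fingroup all_algebra.
From mathcomp Require Import generic_quotient.
From mathcomp Require Import boolp classical_sets.

Set Implicit Arguments.
Unset Strict Implicit.
Unset Printing Implicit Defensive.

Import GRing.Theory.

Local Open Scope ring_scope.
Local Open Scope quotient_scope.

(* Associative unital F-algebras presented by generators and relations: formal
   expressions modulo the congruence generated by the algebra axioms and the
   relations.  The result is only a pzRingType and an lmodType, because
   MathComp's algebra structures include 1 != 0.                              *)

Inductive alg_term (F X : Type) :=
  | TGen of X
  | TZero
  | TOne
  | TOpp of alg_term F X
  | TAdd of alg_term F X & alg_term F X
  | TMul of alg_term F X & alg_term F X
  | TScale of F & alg_term F X.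

Arguments TGen {F X}.
Arguments TZero {F X}.
Arguments TOne {F X}.

HB.instance Definition _ (F X : Type) := gen_eqMixin (alg_term F X).
HB.instance Definition _ (F X : Type) := gen_choiceMixin (alg_term F X).

Declare Scope alg_term_scope.
Delimit Scope alg_term_scope with AT.
Bind Scope alg_term_scope with alg_term.
Notation "0" := TZero : alg_term_scope.
Notation "1" := TOne : alg_term_scope.
Notation "- a" := (TOpp a) : alg_term_scope.
Notation "a + b" := (TAdd a b) : alg_term_scope.
Notation "a * b" := (TMul a b) : alg_term_scope.
Notation "c *: a" := (TScale c a) : alg_term_scope.

Section Presentation.

Variables (F : comNzRingType) (X : Type).

Notation term := (alg_term F X).

Variable rel : term -> term -> Prop.

Inductive alg_eq : term -> term -> Prop :=
  | AERel a b of rel a b : alg_eq a b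
  | AERefl a : alg_eq a a
  | AESym a b of alg_eq a b : alg_eq b a
  | AETrans a b c of alg_eq a b & alg_eq b c : alg_eq a c
  | AEOpp a b of alg_eq a b : alg_eq (- a) (- b)
  | AEAdd a b c d of alg_eq a b & alg_eq c d : alg_eq (a + c) (b + d)
  | AEMul a b c d of alg_eq a b & alg_eq c d : alg_eq (a * c) (b * d)
  | AEScale (k : F) a b of alg_eq a b : alg_eq (k *: a) (k *: b)
  | AEaddA a b c : alg_eq (a + (b + c)) (a + b + c)
  | AEaddC a b : alg_eq (a + b) (b + a)
  | AEadd0 a : alg_eq (0 + a) a
  | AEaddN a : alg_eq (- a + a) 0
  | AEmulA a b c : alg_eq (a * (b * c)) (a * b * c)
  | AEmul1l a : alg_eq (1 * a) a
  | AEmul1r a : alg_eq (a * 1) a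
  | AEmulDl a b c : alg_eq ((a + b) * c) (a * c + b * c)
  | AEmulDr a b c : alg_eq (a * (b + c)) (a * b + a * c)
  | AEscaleA (k l : F) a : alg_eq (k *: (l *: a)) ((k * l)%R *: a)
  | AEscale1 a : alg_eq (1%R *: a) a
  | AEscaleDr (k : F) a b : alg_eq (k *: (a + b)) (k *: a + k *: b)
  | AEscaleDl (k l : F) a : alg_eq ((k + l)%R *: a) (k *: a + l *: a)
  | AEscaleAl (k : F) a b : alg_eq (k *: (a * b)) ((k *: a) * b)
  | AEscaleAr (k : F) a b : alg_eq (k *: (a * b)) (a * (k *: b)).

Definition alg_eqb (a b : term) : bool := `[< alg_eq a b >].

Lemma alg_eqb_equiv : equiv_class_of alg_eqb.
Proof.
split=> [a|a b|b a c]; first by apply/asboolP; apply: AERefl.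
- by apply/asboolP/asboolP; apply: AESym.
- by move=> /asboolP ab /asboolP bc; apply/asboolP; apply: AETrans bc.
Qed.

Canonical alg_eqb_rel := EquivRelPack alg_eqb_equiv.

Definition presented := {eq_quot alg_eqb}.

HB.instance Definition _ := Choice.on presented.

Definition pclass (a : term) : presented := \pi a.
Definition prepr (x : presented) : term := repr x.

Lemma preprK : cancel prepr pclass. Proof. exact: reprK. Qed.

Lemma pclassP a b : pclass a = pclass b <-> alg_eq a b.
Proof. by split=> [/eqmodP/asboolP|ab]; last exact/eqmodP/asboolP. Qed.

Lemma alg_eq_prepr a : alg_eq (prepr (pclass a)) a.
Proof. by apply/pclassP; rewrite preprK. Qed.

Definition popp x := pclass (- prepr x).
Definition padd x y := pclass (prepr x + prepr y).
Definition pmul x y := pclass (prepr x * prepr y).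
Definition pscale (k : F) x := pclass (k *: prepr x).

Lemma poppE a : popp (pclass a) = pclass (- a).
Proof. by apply/pclassP/AEOpp/alg_eq_prepr. Qed.

Lemma paddE a b : padd (pclass a) (pclass b) = pclass (a + b).
Proof. by apply/pclassP/AEAdd; apply/alg_eq_prepr. Qed.

Lemma pmulE a b : pmul (pclass a) (pclass b) = pclass (a * b).
Proof. by apply/pclassP/AEMul; apply/alg_eq_prepr. Qed.

Lemma pscaleE k a : pscale k (pclass a) = pclass (k *: a).
Proof. by apply/pclassP/AEScale/alg_eq_prepr. Qed.

Fact paddA : associative padd.
Proof.
move=> x y z; rewrite -(preprK x) -(preprK y) -(preprK z) !paddE.
exact/pclassP/AEaddA.
Qed.

Fact paddC : commutative padd.
Proof.
by move=> x y; rewrite -(preprK x) -(preprK y) !paddE; apply/pclassP/AEaddC.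
Qed.

Fact padd0 : left_id (pclass 0) padd.
Proof. by move=> x; rewrite -(preprK x) paddE; apply/pclassP/AEadd0. Qed.

Fact paddN : left_inverse (pclass 0) popp padd.
Proof. by move=> x; rewrite -(preprK x) poppE paddE; apply/pclassP/AEaddN. Qed.

HB.instance Definition _ :=
  GRing.isZmodule.Build presented paddA paddC padd0 paddN.

Fact pmulA : associative pmul.
Proof.
move=> x y z; rewrite -(preprK x) -(preprK y) -(preprK z) !pmulE.
exact/pclassP/AEmulA.
Qed.

Fact pmul1l : left_id (pclass 1) pmul.
Proof. by move=> x; rewrite -(preprK x) pmulE; apply/pclassP/AEmul1l. Qed.

Fact pmul1r : right_id (pclass 1) pmul.
Proof. by move=> x; rewrite -(preprK x) pmulE; apply/pclassP/AEmul1r. Qed.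

Fact pmulDl : left_distributive pmul padd.
Proof.
move=> x y z; rewrite -(preprK x) -(preprK y) -(preprK z) !(paddE, pmulE).
exact/pclassP/AEmulDl.
Qed.

Fact pmulDr : right_distributive pmul padd.
Proof.
move=> x y z; rewrite -(preprK x) -(preprK y) -(preprK z) !(paddE, pmulE).
exact/pclassP/AEmulDr.
Qed.

HB.instance Definition _ :=
  GRing.Zmodule_isPzRing.Build presented pmulA pmul1l pmul1r pmulDl pmulDr.

Fact pscaleA k l x : pscale k (pscale l x) = pscale (k * l) x.
Proof. by rewrite -(preprK x) !pscaleE; apply/pclassP/AEscaleA. Qed.

Fact pscale1 : left_id 1 pscale.
Proof. by move=> x; rewrite -(preprK x) pscaleE; apply/pclassP/AEscale1. Qed.

Fact pscaleDr : right_distributive pscale padd.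
Proof.
move=> k x y; rewrite -(preprK x) -(preprK y) !(paddE, pscaleE).
exact/pclassP/AEscaleDr.
Qed.

Fact pscaleDl x : {morph pscale^~ x : k l / k + l >-> padd k l}.
Proof.
by move=> k l; rewrite -(preprK x) !pscaleE paddE; apply/pclassP/AEscaleDl.
Qed.

HB.instance Definition _ :=
  GRing.Zmodule_isLmodule.Build F presented pscaleA pscale1 pscaleDr pscaleDl.

Lemma pclass1 : pclass 1 = 1. Proof. by []. Qed.

Lemma pclassN a : pclass (- a) = - pclass a.
Proof. exact/esym/poppE. Qed.

Lemma pclassD a b : pclass (a + b) = pclass a + pclass b.
Proof. exact/esym/paddE. Qed.

Lemma pclassM a b : pclass (a * b) = pclass a * pclass b.
Proof. exact/esym/pmulE. Qed.

Lemma pclassZ k a : pclass (k *: a) = k *: pclass a.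
Proof. exact/esym/pscaleE. Qed.

Lemma pscalerAl (k : F) (x y : presented) : k *: (x * y) = (k *: x) * y.
Proof.
rewrite -(preprK x) -(preprK y) -pclassM -!pclassZ -pclassM.
exact/pclassP/AEscaleAl.
Qed.

Lemma pscalerAr (k : F) (x y : presented) : k *: (x * y) = x * (k *: y).
Proof.
rewrite -(preprK x) -(preprK y) -pclassM -!pclassZ -pclassM.
exact/pclassP/AEscaleAr.
Qed.

Definition pgen (x : X) : presented := pclass (TGen x).

Lemma pclass_rel a b : rel a b -> pclass a = pclass b.
Proof. by move=> ab; apply/pclassP/AERel. Qed.

End Presentation.

Section Evaluation.

Variables (F : comNzRingType) (X Y : Type).
Variables (rel : alg_term F X -> alg_term F X -> Prop).
Variables (rel' : alg_term F Y -> alg_term F Y -> Prop).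
Variable h : X -> presented rel'.

Fixpoint peval (a : alg_term F X) : presented rel' :=
  match a with
  | TGen x => h x
  | TZero => 0
  | TOne => 1
  | TOpp a => - peval a
  | TAdd a b => peval a + peval b
  | TMul a b => peval a * peval b
  | TScale k a => k *: peval a
  end.

(* The algebra morphism sending each generator x to h x; by pliftE it does not
   depend on the representative if h respects the relations.                  *)
Definition plift (x : presented rel) : presented rel' := peval (prepr x).

Hypothesis h_rel : forall a b, rel a b -> peval a = peval b.

Lemma peval_eq a b : alg_eq rel a b -> peval a = peval b.
Proof.
elim=> {a b} //=.
- by move=> a b c _ ->.
- by move=> a b _ ->.
- by move=> a b c d _ -> _ ->.
- by move=> a b c d _ -> _ ->.
- by move=> k a b _ ->.
- by move=> *; rewrite addrA.
- by move=> *; rewrite addrC.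
- by move=> *; rewrite add0r.
- by move=> *; rewrite addNr.
- by move=> *; rewrite mulrA.
- by move=> *; rewrite mul1r.
- by move=> *; rewrite mulr1.
- by move=> *; rewrite mulrDl.
- by move=> *; rewrite mulrDr.
- by move=> *; rewrite scalerA.
- by move=> *; rewrite scale1r.
- by move=> *; rewrite scalerDr.
- by move=> *; rewrite scalerDl.
- by move=> *; rewrite pscalerAl.
- by move=> *; rewrite pscalerAr.
Qed.

Lemma pliftE a : plift (pclass rel a) = peval a.
Proof. exact/peval_eq/alg_eq_prepr. Qed.

End Evaluation.

Section SkewPolynomials.

Variables (F : comNzRingType) (n : nat).

Variant skew_rel : alg_term F 'I_n -> alg_term F 'I_n -> Prop :=
  | SkewComm i j of i != j :
      skew_rel (TGen i * TGen j) (- (TGen j * TGen i)).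

Definition skew_poly := presented skew_rel.

HB.instance Definition _ := GRing.PzRing.on skew_poly.
HB.instance Definition _ := GRing.Lmodule.on skew_poly.

Definition sxi (i : 'I_n) : skew_poly := pgen skew_rel i.

(* f |-> f^s, where xi_j^s = xi_(s j) *)
Definition sperm (s : 'S_n) : skew_poly -> skew_poly :=
  plift (fun j => sxi (s j)).

Definition stau (i : 'I_n) : skew_poly -> skew_poly :=
  plift (fun j => if j == i then - sxi j else sxi j).

Definition sparity : alg_term F 'I_n -> skew_poly := peval (fun j => - sxi j).

(* The super Leibniz rule D (a b) = D a b + (-1)^|a| a D b; partial_monomial
   below is the resulting formula on monomials.                             *)
Fixpoint partial_term (i : 'I_n) (a : alg_term F 'I_n) : skew_poly :=
  match a with
  | TGen j => (j == i)%:R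
  | TZero => 0
  | TOne => 0
  | TOpp a => - partial_term i a
  | TAdd a b => partial_term i a + partial_term i b
  | TMul a b => partial_term i a * pclass skew_rel b +
                sparity a * partial_term i b
  | TScale k a => k *: partial_term i a
  end.

Definition partial (i : 'I_n) (f : skew_poly) : skew_poly :=
  partial_term i (prepr f).

Lemma sxi_anti i j : i != j -> sxi i * sxi j = - (sxi j * sxi i).
Proof. by move=> ij; rewrite -!pclassM -pclassN; apply/pclass_rel. Qed.

Lemma spermE s a :
  sperm s (pclass skew_rel a) = peval (fun j => sxi (s j)) a.
Proof.
apply: pliftE => _ _ [i j ij] /=.
by apply: sxi_anti; rewrite (inj_eq perm_inj).
Qed.

Lemma stauE i a :
  stau i (pclass skew_rel a) =
  peval (fun j => if j == i then - sxi j else sxi j) a.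
Proof.
apply: pliftE => _ _ [j k jk] /=.
by do 2!case: ifP => _; rewrite ?(mulrN, mulNr) (sxi_anti jk) ?opprK.
Qed.

Lemma sparity_rel a b : skew_rel a b -> sparity a = sparity b.
Proof. by case=> i j ij; rewrite /sparity /= !mulrNN; apply: sxi_anti. Qed.

Lemma partial_term_eq i a b :
  alg_eq skew_rel a b -> partial_term i a = partial_term i b.
Proof.
have E x y : alg_eq skew_rel x y ->
    sparity x = sparity y /\ pclass skew_rel x = pclass skew_rel y.
  by move=> xy; split; [apply: peval_eq xy; apply: sparity_rel|apply/pclassP].
move=> ab; elim: a b / ab => //=.
- move=> _ _ [j k jk] /=; rewrite -!/(pgen _ _) /sparity /=.
  have CC (b : bool) (x : skew_poly) : b%:R * x = x * b%:R.
    by case: b; rewrite ?mul1r ?mulr1 ?mul0r ?mulr0.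
  by rewrite !mulNr opprD opprK !CC addrC.
- by move=> x y z _ ->.
- by move=> x y _ ->.
- by move=> x y z w _ -> _ ->.
- by move=> x y z w /E[Pxy cxy] -> /E[Pzw czw] ->; rewrite Pxy czw.
- by move=> k x y _ ->.
- by move=> *; rewrite addrA.
- by move=> *; rewrite addrC.
- by move=> *; rewrite add0r.
- by move=> *; rewrite addNr.
- by move=> x y z; rewrite pclassM mulrDl mulrDr addrA !mulrA.
- by move=> x; rewrite mul0r add0r /sparity /= mul1r.
- by move=> x; rewrite mulr0 addr0 (pclass1 skew_rel) mulr1.
- move=> x y z; rewrite /sparity /= !mulrDl !addrA; congr (_ + _).
  by rewrite addrAC.
- by move=> x y z; rewrite pclassD !mulrDr addrACA.
- by move=> *; rewrite scalerA.
- by move=> *; rewrite scale1r.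
- by move=> *; rewrite scalerDr.
- by move=> *; rewrite scalerDl.
- by move=> k x y; rewrite /sparity /= scalerDr -!pscalerAl.
- by move=> k x y; rewrite pclassZ scalerDr -!pscalerAr.
Qed.

Lemma partialE i a : partial i (pclass skew_rel a) = partial_term i a.
Proof. exact/partial_term_eq/alg_eq_prepr. Qed.

Lemma partial_monomial i (w : seq 'I_n) :
  partial i (\prod_(a <- w) sxi a) =
  \sum_(k < size w) (-1) ^+ k *:
    ((\prod_(a <- take k w) sxi a) * (nth i w k == i)%:R *
     (\prod_(a <- drop k.+1 w) sxi a)).
Proof.
elim: w => [|j w IH]; first by rewrite big_nil big_ord0 partialE.
rewrite big_cons big_ord_recl /= drop0 big_nil mul1r scale1r.
rewrite -[\prod_(a <- w) _](preprK) -pclassM partialE /= preprK.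
congr (_ + _); rewrite /sparity /= mulNr -[partial_term _ _]/(partial i _) IH.
rewrite mulr_sumr -sumrN; apply: eq_bigr => k _.
rewrite big_cons -pscalerAr exprS mulN1r scaleNr !mulrA; congr (- _).
Qed.

(* The quotient h / d, when there is one. *)
Definition skew_div (h d : skew_poly) : skew_poly :=
  xget 0 [set g | d * g = h]%classic.

Definition dunkl_num (i k : 'I_n) (f : skew_poly) : skew_poly :=
  (sxi i - sxi k) * sperm (tperm i k) f -
  (sxi i * stau i f - sxi k * stau k f).

Definition dunkl (t u : F) (i : 'I_n) (f : skew_poly) : skew_poly :=
  t *: partial i f +
  u *: \sum_(k < n | k != i)
         skew_div (dunkl_num i k f) (sxi i ^+ 2 - sxi k ^+ 2).

End SkewPolynomials.

Section OddDAHA.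

Variables (F : comNzRingType) (n : nat) (t u : F).

Variant daha_gen := GXi of 'I_n | GEta of 'I_n | GSigma of 'S_n.

Local Notation term := (alg_term F daha_gen).
Let X i : term := TGen (GXi i).
Let H i : term := TGen (GEta i).
Let W s : term := TGen (GSigma s).

(* The first two relations present the group algebra of S_n.  In MathComp
   (s * r) j = r (s j), so that the composite j |-> s (r j) is r * s.      *)
Variant daha_rel : term -> term -> Prop :=
  | RelW1 : daha_rel (W 1%g) 1
  | RelWM s r : daha_rel (W s * W r) (W (r * s)%g)
  | RelEta i j of i != j : daha_rel (H i * H j) (- (H j * H i))
  | RelXi i j of i != j : daha_rel (X i * X j) (- (X j * X i))
  | RelWXi s j : daha_rel (W s * X j) (X (s j) * W s)
  | RelWEta s j : daha_rel (W s * H j) (H (s j) * W s)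
  | RelEtaXi i j of i != j :
      daha_rel (H i * X j + X j * H i) (u *: W (tperm i j))
  | RelEtaXi_diag i :
      daha_rel (H i * X i + X i * H i)
        (t *: 1 + u *: \big[@TAdd _ _/0%AT]_(k < n | k != i) W (tperm k i)).

Definition odd_daha := presented daha_rel.

HB.instance Definition _ := GRing.PzRing.on odd_daha.
HB.instance Definition _ := GRing.Lmodule.on odd_daha.

Definition dxi i : odd_daha := pgen daha_rel (GXi i).
Definition deta i : odd_daha := pgen daha_rel (GEta i).
Definition dsigma s : odd_daha := pgen daha_rel (GSigma s).

Definition is_subalgebra (P : odd_daha -> Prop) : Prop :=
  [/\ P 1, forall x y, P x -> P y -> P (x - y),
      forall x y, P x -> P y -> P (x * y) & forall (c : F) x, P x -> P (c *: x)].

(* Membership in the subalgebra generated by the eta_i and C W *)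
Definition in_heta (x : odd_daha) : Prop :=
  forall P, is_subalgebra P -> (forall i, P (deta i)) ->
  (forall s, P (dsigma s)) -> P x.

Lemma in_heta_subalgebra : is_subalgebra in_heta.
Proof.
split=> [P [] //|x y Px Py P PP Pe Ps|x y Px Py P PP Pe Ps|c x Px P PP Pe Ps];
  case: (PP) => _ PB PM PZ.
- by apply: PB; [apply: Px|apply: Py].
- by apply: PM; [apply: Px|apply: Py].
- by apply: PZ; apply: Px.
Qed.

Definition heta_pred : {pred odd_daha} := fun x => `[< in_heta x >].

Lemma heta_subring_closed : subring_closed heta_pred.
Proof.
case: in_heta_subalgebra => P1 PB PM _; split=> [|x y|x y]; first exact/asboolP.
- by move=> /asboolP Px /asboolP Py; apply/asboolP; exact: (PB _ _ Px Py).
- by move=> /asboolP Px /asboolP Py; apply/asboolP; exact: (PM _ _ Px Py).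
Qed.

HB.instance Definition _ :=
  GRing.isSubringClosed.Build odd_daha heta_pred heta_subring_closed.

Record heta := HEta { heta_val :> odd_daha; _ : heta_val \in heta_pred }.

HB.instance Definition _ := [isSub for heta_val].
HB.instance Definition _ := [Choice of heta by <:].
HB.instance Definition _ :=
  GRing.SubChoice_isSubPzRing.Build odd_daha heta_pred heta heta_subring_closed.

Fact heta_scalar_subproof (c : F) : c *: (1 : odd_daha) \in heta_pred.
Proof.
by case: in_heta_subalgebra => P1 _ _ PZ; apply/asboolP; exact: (PZ _ _ P1).
Qed.
Definition heta_scalar c : heta := HEta (heta_scalar_subproof c).

Fact heta_eta_subproof i : deta i \in heta_pred.
Proof. by apply/asboolP => P _ Pe _. Qed.
Definition heta_eta i : heta := HEta (heta_eta_subproof i).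

Fact heta_sigma_subproof s : dsigma s \in heta_pred.
Proof. by apply/asboolP => P _ _ Ps. Qed.
Definition heta_sigma s : heta := HEta (heta_sigma_subproof s).

Definition xi_embed : skew_poly F n -> odd_daha := plift dxi.

Lemma xi_embedE a :
  xi_embed (pclass (@skew_rel F n) a) = peval dxi a.
Proof.
apply: pliftE => _ _ [i j ij] /=; rewrite -!pclassM -pclassN.
exact/pclass_rel/RelXi.
Qed.

(* V is one-dimensional over the scalars, W acts trivially, every eta_i by 0. *)
Definition is_trivial_module (V : lmodType heta) : Prop :=
  [/\ exists2 v0 : V, v0 != 0 & forall v, exists c, v = heta_scalar c *: v0,
      forall s (v : V), heta_sigma s *: v = v
    & forall i (v : V), heta_eta i *: v = 0].

End OddDAHA.

(* Extension of scalars A (x)_B V along f : B -> A, as an A-module: the abelian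
   group generated by the symbols a (x) v subject to additivity in a and in v
   and to a f(b) (x) v = a (x) b v.                                            *)

Inductive tens_term (A V : Type) :=
  | TensPure of A & V
  | TensZero
  | TensOpp of tens_term A V
  | TensAdd of tens_term A V & tens_term A V.

Arguments TensZero {A V}.

HB.instance Definition _ (A V : Type) := gen_eqMixin (tens_term A V).
HB.instance Definition _ (A V : Type) := gen_choiceMixin (tens_term A V).

Section ExtensionOfScalars.

Variables (A B : pzRingType) (f : {rmorphism B -> A}) (V : lmodType B).

Local Notation term := (tens_term A V).

Inductive tens_eq : term -> term -> Prop :=
  | TERefl x : tens_eq x x
  | TESym x y of tens_eq x y : tens_eq y x
  | TETrans x y z of tens_eq x y & tens_eq y z : tens_eq x z
  | TEOpp x y of tens_eq x y : tens_eq (TensOpp x) (TensOpp y)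
  | TEAdd x y z w of tens_eq x y & tens_eq z w :
      tens_eq (TensAdd x z) (TensAdd y w)
  | TEaddA x y z : tens_eq (TensAdd x (TensAdd y z)) (TensAdd (TensAdd x y) z)
  | TEaddC x y : tens_eq (TensAdd x y) (TensAdd y x)
  | TEadd0 x : tens_eq (TensAdd TensZero x) x
  | TEaddN x : tens_eq (TensAdd (TensOpp x) x) TensZero
  | TEpureDl a b v :
      tens_eq (TensPure (a + b) v) (TensAdd (TensPure a v) (TensPure b v))
  | TEpureDr a v w :
      tens_eq (TensPure a (v + w)) (TensAdd (TensPure a v) (TensPure a w))
  | TEbalanced a b v : tens_eq (TensPure (a * f b) v) (TensPure a (b *: v)).

Definition tens_eqb (x y : term) : bool := `[< tens_eq x y >].

Lemma tens_eqb_equiv : equiv_class_of tens_eqb.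
Proof.
split=> [x|x y|y x z]; first by apply/asboolP; apply: TERefl.
- by apply/asboolP/asboolP; apply: TESym.
- by move=> /asboolP xy /asboolP yz; apply/asboolP; apply: TETrans yz.
Qed.

Canonical tens_eqb_rel := EquivRelPack tens_eqb_equiv.

Definition tensor := {eq_quot tens_eqb}.

HB.instance Definition _ := Choice.on tensor.

Definition tclass (x : term) : tensor := \pi x.
Definition trepr (x : tensor) : term := repr x.

Lemma treprK : cancel trepr tclass. Proof. exact: reprK. Qed.

Lemma tclassP x y : tclass x = tclass y <-> tens_eq x y.
Proof. by split=> [/eqmodP/asboolP|xy]; last exact/eqmodP/asboolP. Qed.

Lemma tens_eq_trepr x : tens_eq (trepr (tclass x)) x.
Proof. by apply/tclassP; rewrite treprK. Qed.

Fixpoint tens_act (a : A) (x : term) : term :=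
  match x with
  | TensPure b v => TensPure (a * b) v
  | TensZero => TensZero
  | TensOpp x => TensOpp (tens_act a x)
  | TensAdd x y => TensAdd (tens_act a x) (tens_act a y)
  end.

Lemma tens_act_eq a x y : tens_eq x y -> tens_eq (tens_act a x) (tens_act a y).
Proof.
elim=> {x y} /=.
- by move=> x; apply: TERefl.
- by move=> x y _; apply: TESym.
- by move=> x y z _ xy _; apply: TETrans xy.
- by move=> x y _; apply: TEOpp.
- by move=> x y z w _ xy _; apply: TEAdd.
- by move=> x y z; apply: TEaddA.
- by move=> x y; apply: TEaddC.
- by move=> x; apply: TEadd0.
- by move=> x; apply: TEaddN.
- by move=> b c v; rewrite mulrDr; apply: TEpureDl.
- by move=> b v w; apply: TEpureDr.
- by move=> b c v; rewrite mulrA; apply: TEbalanced.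
Qed.

Definition topp x := tclass (TensOpp (trepr x)).
Definition tadd x y := tclass (TensAdd (trepr x) (trepr y)).
Definition tscale a x := tclass (tens_act a (trepr x)).

Lemma toppE x : topp (tclass x) = tclass (TensOpp x).
Proof. by apply/tclassP/TEOpp/tens_eq_trepr. Qed.

Lemma taddE x y : tadd (tclass x) (tclass y) = tclass (TensAdd x y).
Proof. by apply/tclassP/TEAdd; apply/tens_eq_trepr. Qed.

Lemma tscaleE a x : tscale a (tclass x) = tclass (tens_act a x).
Proof. by apply/tclassP/tens_act_eq/tens_eq_trepr. Qed.

Fact taddA : associative tadd.
Proof.
move=> x y z; rewrite -(treprK x) -(treprK y) -(treprK z) !taddE.
exact/tclassP/TEaddA.
Qed.

Fact taddC : commutative tadd.
Proof.
by move=> x y; rewrite -(treprK x) -(treprK y) !taddE; apply/tclassP/TEaddC.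
Qed.

Fact tadd0 : left_id (tclass TensZero) tadd.
Proof. by move=> x; rewrite -(treprK x) taddE; apply/tclassP/TEadd0. Qed.

Fact taddN : left_inverse (tclass TensZero) topp tadd.
Proof. by move=> x; rewrite -(treprK x) toppE taddE; apply/tclassP/TEaddN. Qed.

HB.instance Definition _ :=
  GRing.isZmodule.Build tensor taddA taddC tadd0 taddN.

Fact tscaleA a b x : tscale a (tscale b x) = tscale (a * b) x.
Proof.
rewrite -(treprK x) !tscaleE; congr tclass.
by elim: (trepr x) => //= [c v|y ->|y -> z ->] //; rewrite mulrA.
Qed.

Fact tscale1 : left_id 1 tscale.
Proof.
move=> x; rewrite -(treprK x) tscaleE; congr tclass.
by elim: (trepr x) => //= [c v|y ->|y -> z ->] //; rewrite mul1r.
Qed.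

Fact tscaleDr : right_distributive tscale tadd.
Proof.
move=> a x y; rewrite -(treprK x) -(treprK y).
by rewrite taddE !tscaleE taddE.
Qed.

Fact tscaleDl x : {morph tscale^~ x : a b / a + b >-> tadd a b}.
Proof.
move=> a b; rewrite -(treprK x) !tscaleE taddE; apply/tclassP.
elim: (trepr x) => /= [c v||y IH|y IHy z IHz].
- by rewrite mulrDl; apply: TEpureDl.
- by apply/TESym/TEadd0.
- apply/tclassP; rewrite -!(toppE, taddE); move/tclassP: IH => ->.
  by rewrite -taddE; apply: (opprD (tclass _) (tclass _)).
- apply/tclassP; rewrite -!(toppE, taddE).
  move/tclassP: IHy => ->; move/tclassP: IHz => ->.
  by rewrite -!taddE; apply: (addrACA (tclass _) (tclass _)).
Qed.

HB.instance Definition _ :=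
  GRing.Zmodule_isLmodule.Build A tensor tscaleA tscale1 tscaleDr tscaleDl.

Definition tpure (a : A) (v : V) : tensor := tclass (TensPure a v).

Lemma tpureDl a b v : tpure (a + b) v = tpure a v + tpure b v.
Proof. rewrite /tpure [RHS]taddE; exact/tclassP/TEpureDl. Qed.

Lemma tpureDr a v w : tpure a (v + w) = tpure a v + tpure a w.
Proof. rewrite /tpure [RHS]taddE; exact/tclassP/TEpureDr. Qed.

Lemma tpure_balanced a b v : tpure (a * f b) v = tpure a (b *: v).
Proof. exact/tclassP/TEbalanced. Qed.

Lemma scale_tpure a b v : a *: tpure b v = tpure (a * b) v.
Proof. exact: tscaleE. Qed.

End ExtensionOfScalars.

Section InducedModule.

Variables (F : comNzRingType) (n : nat) (t u : F) (V : lmodType (heta n t u)).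

Definition induced : lmodType (odd_daha n t u) :=
  tensor (\val : {rmorphism heta n t u -> odd_daha n t u}) V.

(* The identification of C[xi_1, ..., xi_n] with the induced module. *)
Definition skew_to_induced (v0 : V) (f : skew_poly F n) : induced :=
  tpure _ (xi_embed t u f) v0.

(* phi identifies C[xi_1, ..., xi_n] with the induced module, the generator v0
   of V being 1, in such a way that xi_i acts by left multiplication and s by
   f |-> f^s.                                                                  *)
Definition is_identification (v0 : V) (phi : skew_poly F n -> induced) : Prop :=
  [/\ bijective phi /\ phi 1 = tpure _ 1 v0,
      forall f g, phi (f + g) = phi f + phi g,
      forall (c : F) f, phi (c *: f) = (c *: (1 : odd_daha n t u)) *: phi f,
      forall i f, phi (sxi F i * f) = dxi t u i *: phi f
    & forall s f, phi (sperm s f) = dsigma t u s *: phi f].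

End InducedModule.

(* Main.v *)
From HB Require Import structures.
Require Import Defs.
From mathcomp Require Import all_boot all_order all_fingroup all_algebra.
From mathcomp Require Import reals complex mpoly.

Set Implicit Arguments.
Unset Strict Implicit.
Unset Printing Implicit Defensive.

Import GRing.Theory.
Local Open Scope ring_scope.

(** The induced module is free on the monomials in the xi_i, and everything
    follows once the odd double affine Hecke algebra is known to act on the
    skew polynomials by the Dunkl operators.  Let z = xi_i^2 - xi_k^2, let
    N_ik f be the numerator of the Dunkl quotient and s the transposition of i
    and k.

    The quotients exist because of the recursion

      N_ik (xi_j f) = - xi_j N_ik f + [j = i or j = k] z s(f),   N_ik 1 = 0

    (dunkl_numMxi), z being central; they are unique because z is not a zero
    divisor.  For the latter, the skew polynomials are compared with ordinary
    ones: xi_i acts on ordinary polynomials as multiplication by X_i after the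
    substitution X_j -> - X_j for j < i, ordered monomials go to monomials
    (mpoly_of_skewK), and z acts as multiplication by X_i^2 - X_k^2
    (sxi_sqrB_inj).

    Dividing the recursion by z shows that the Dunkl operators, denoted eta_i
    here, satisfy eta_i 1 = 0 and

      eta_i (xi_j f) = - xi_j eta_i f + B_ij f

    where B_ij is the bracket of eta_i and xi_j prescribed by the algebra
    (dunklMxi).  As the xi_j generate the skew polynomials from 1, these two
    facts determine the eta_i.  So an identity between operators can be proved
    by checking it on 1 and checking that it passes from f to xi_j f
    (skew_linear_eq).  This gives the equivariance of the eta_i under S_n
    (sperm_dunkl) and, since the anticommutator of eta_i and eta_j commutes
    with every xi_k by a Jacobi identity (dunkl_bracket_cyclic), also
    eta_i eta_j = - eta_j eta_i (dunkl_anti).  Hence all relations hold and the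
    algebra acts (dunkl_rep).

    The subalgebra generated by the eta_i and the group multiplies 1 by
    scalars in this representation, which yields the character defining the
    trivial module (trivial_moduleP); that such a character exists is not
    apparent from the presentation.  Finally, for any trivial module spanned
    by v0, the map f -> f (x) v0 has the left inverse
    a (x) (c v0) -> c (a 1), and intertwines dunkl_rep with the action on the
    induced module (skew_to_induced_rep): for the eta_i both sides obey the
    recursion above.  The intertwining also gives surjectivity, since the
    induced module is generated by 1 (x) v0. *)

(** * Actions of a presented algebra *)

Section LinearFacts.

Variables (F : pzRingType) (U V : lmodType F) (D : U -> V).
Hypothesis D_linear : linear D.

Lemma linear_mapZ k x : D (k *: x) = k *: D x.
Proof. exact: (scalable_linear D_linear). Qed.

Lemma linear_map0 : D 0 = 0.
Proof. by rewrite -{1}(scale0r (0 : U)) linear_mapZ scale0r. Qed.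

Lemma linear_mapD x y : D (x + y) = D x + D y.
Proof. by rewrite -{1}[x]scale1r D_linear scale1r. Qed.

Lemma linear_mapN x : D (- x) = - D x.
Proof. by rewrite -scaleN1r linear_mapZ scaleN1r. Qed.

End LinearFacts.

(** An assignment of linear operators to the generators that respects the
    relations makes the presented algebra act.  The morphisms built by plift
    take values in presented algebras, so operators on a module need an
    evaluation of their own. *)
Section PresentedAction.

Variables (F : comNzRingType) (X : Type) (M : lmodType F) (h : X -> M -> M).
Hypothesis h_linear : forall x, linear (h x).

Fixpoint term_act (a : alg_term F X) (m : M) : M :=
  match a with
  | TGen x => h x m
  | TZero => 0
  | TOne => m
  | TOpp a => - term_act a m
  | TAdd a b => term_act a m + term_act b m
  | TMul a b => term_act a (term_act b m)
  | TScale k a => k *: term_act a m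
  end.

Lemma term_act_linear a : linear (term_act a).
Proof.
elim: a => [x||| a IH|a IHa b IHb|a IHa b IHb|c a IH] k f g //=.
- exact: h_linear.
- by rewrite scaler0 addr0.
- by rewrite IH opprD scalerN.
- by rewrite IHa IHb scalerDr addrACA.
- by rewrite IHb IHa.
- by rewrite IH scalerDr !scalerA mulrC.
Qed.

Variable rel : alg_term F X -> alg_term F X -> Prop.
Hypothesis h_rel : forall a b, rel a b -> term_act a =1 term_act b.

Lemma term_act_eq a b : alg_eq rel a b -> term_act a =1 term_act b.
Proof.
elim=> {a b} //=.
- by move=> a b _ ab m; rewrite ab.
- by move=> a b c _ ab _ bc m; rewrite ab.
- by move=> a b _ ab m /=; rewrite ab.
- by move=> a b c d _ ab _ cd m /=; rewrite ab cd.
- by move=> a b c d _ ab _ cd m /=; rewrite cd ab.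
- by move=> k a b _ ab m /=; rewrite ab.
- by move=> a b c m /=; rewrite addrA.
- by move=> a b m /=; rewrite addrC.
- by move=> a m /=; rewrite add0r.
- by move=> a m /=; rewrite addNr.
- by move=> a b c m /=; rewrite (linear_mapD (term_act_linear a)).
- by move=> k l a m /=; rewrite scalerA.
- by move=> a m /=; rewrite scale1r.
- by move=> k a b m /=; rewrite scalerDr.
- by move=> k l a m /=; rewrite scalerDl.
- by move=> k a b m /=; rewrite (linear_mapZ (term_act_linear a)).
Qed.

Definition pact (x : presented rel) : M -> M := term_act (prepr x).

Lemma pactE a : pact (pclass rel a) =1 term_act a.
Proof. exact/term_act_eq/alg_eq_prepr. Qed.

Lemma pact_linear x : linear (pact x).
Proof. exact: term_act_linear. Qed.

Lemma pact1 m : pact 1 m = m.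
Proof. by rewrite -pclass1 pactE. Qed.

Lemma pact_gen x m : pact (pgen rel x) m = h x m.
Proof. exact: pactE. Qed.

Lemma pactDl x y m : pact (x + y) m = pact x m + pact y m.
Proof. by rewrite -(preprK x) -(preprK y) -pclassD !pactE. Qed.

Lemma pactNl x m : pact (- x) m = - pact x m.
Proof. by rewrite -(preprK x) -pclassN !pactE. Qed.

Lemma pactM x y m : pact (x * y) m = pact x (pact y m).
Proof. by rewrite -(preprK x) -(preprK y) -pclassM !pactE. Qed.

Lemma pactZl k x m : pact (k *: x) m = k *: pact x m.
Proof. by rewrite -(preprK x) -pclassZ !pactE. Qed.

End PresentedAction.

(** * Induction on skew polynomials *)

Section SkewBasics.

Variables (F : comNzRingType) (n : nat).
Local Notation skew := (skew_poly F n).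
Local Notation xi := (@sxi F n).

(** The constant 1 and left multiplications by the generators reach every skew
    polynomial.  All operators below obey a rule for their value on xi_i f, so
    this form of induction fits them better than one on formal expressions. *)
Lemma skew_ind (P : skew -> Prop) :
  P 1 -> (forall k f g, P f -> P g -> P (k *: f + g)) ->
  (forall i f, P f -> P (xi i * f)) -> forall f, P f.
Proof.
move=> P1 Plin Pxi f.
have P0 : P 0 by rewrite -(addNr (1 : skew)) -scaleN1r; apply: Plin.
have PZ k g : P g -> P (k *: g).
  by move=> Pg; rewrite -[k *: g]addr0; apply: Plin.
have PN g : P g -> P (- g) by rewrite -scaleN1r; apply: PZ.
have PD g g' : P g -> P g' -> P (g + g').
  by move=> Pg Pg'; rewrite -[g]scale1r; apply: Plin.
rewrite -[f]mulr1 -[f]preprK.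
elim: (prepr f) 1 P1 => {f} [i||| a IH|a IHa b IHb|a IHa b IHb|k a IH] g Pg.
- exact: Pxi.
- by rewrite (mul0r g).
- by rewrite (mul1r g).
- by rewrite pclassN mulNr; apply/PN/IH.
- by rewrite pclassD mulrDl; apply: PD; [apply: IHa|apply: IHb].
- by rewrite pclassM -mulrA; apply/IHa/IHb.
- by rewrite pclassZ -pscalerAl; apply/PZ/IH.
Qed.

Lemma skew_linear_eq (M : lmodType F) (D E : skew -> M) :
  linear D -> linear E -> D 1 = E 1 ->
  (forall i f, D f = E f -> D (xi i * f) = E (xi i * f)) -> D =1 E.
Proof.
move=> Dl El DE1 DExi; elim/skew_ind => // k f g Df Dg.
by rewrite Dl El Df Dg.
Qed.

End SkewBasics.

(** * Comparison with commutative polynomials *)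

Section MonomialBasis.

Variables (F : comNzRingType) (n : nat).
Local Notation skew := (skew_poly F n).
Local Notation xi := (@sxi F n).
Local Notation mono m := ('X_[m] : {mpoly F[n]}).

Lemma mpoly_linear_eq (M : lmodType F) (D E : {mpoly F[n]} -> M) :
  linear D -> linear E -> (forall m, D (mono m) = E (mono m)) -> D =1 E.
Proof.
move=> Dl El DE; elim/mpolyind => [|c m p _ _ IH]; last by rewrite Dl El DE IH.
by rewrite !linear_map0.
Qed.

(** Commuting xi_i past the ordered monomial x^m up to its own place costs one
    sign for each variable of smaller index, with multiplicity; sign_twist
    produces this sign and mult_below is its exponent on x^m. *)
Definition sign_twist (i : 'I_n) (p : {mpoly F[n]}) : {mpoly F[n]} :=
  p \mPo [tuple if (j < i)%N then - 'X_j else 'X_j | j < n].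

Definition mult_below (i : 'I_n) (m : 'X_{1.. n}) : nat :=
  (\sum_(j < n | (j < i)%N) m j)%N.

Lemma sign_twistX i m :
  sign_twist i (mono m) = (-1) ^+ mult_below i m *: mono m.
Proof.
rewrite /sign_twist comp_mpolyX mpolyXE_id /mult_below.
rewrite [X in _ ^+ X]big_mkcond expr_sum.
rewrite -scaler_prod; apply: eq_bigr => j _; rewrite tnth_mktuple.
case: ifP => _; last by rewrite scale1r.
by rewrite -scaleN1r exprZn.
Qed.

Definition model_xi (i : 'I_n) (p : {mpoly F[n]}) : {mpoly F[n]} :=
  'X_i * sign_twist i p.

Lemma model_xi_linear i : linear (model_xi i).
Proof.
by move=> k p q; rewrite /model_xi /sign_twist linearP mulrDr scalerAr.
Qed.

Lemma model_xiX i m :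
  model_xi i (mono m) = (-1) ^+ mult_below i m *: mono (m + U_(i))%MM.
Proof. by rewrite /model_xi sign_twistX -scalerAr mulrC -mpolyXD. Qed.

Lemma mult_belowD i j m :
  mult_below i (m + U_(j))%MM = (mult_below i m + (j < i))%N.
Proof.
rewrite /mult_below -[(j < i)%N in RHS]andTb big_mkcond [in RHS]big_mkcond /=.
rewrite [RHS]addnC (bigD1 j) //= [in RHS](bigD1 j) //= addnA; congr (_ + _)%N.
  by case: ifP => _; rewrite // mnmDE mnm1E eqxx addnC.
apply: eq_bigr => k kj; case: ifP => _; rewrite // mnmDE mnm1E.
by rewrite eq_sym (negPf kj) addn0.
Qed.

Lemma model_xi_comp_linear i j : linear (model_xi i \o model_xi j).
Proof. by move=> k p q /=; rewrite !model_xi_linear. Qed.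

Lemma model_xi_anti i j p :
  i != j -> model_xi i (model_xi j p) = - model_xi j (model_xi i p).
Proof.
move=> ij; apply: (@mpoly_linear_eq _ (model_xi i \o model_xi j)
  (fun p => - (model_xi j \o model_xi i) p)) => [||m /=].
- exact: model_xi_comp_linear.
- by move=> k q r; rewrite model_xi_comp_linear opprD scalerN.
have modelZ k := linear_mapZ (model_xi_linear k).
rewrite !model_xiX !modelZ !model_xiX !mult_belowD !scalerA -!exprD -scaleNr.
rewrite -addmA (addmC U_(j)%MM) addmA; congr (_ *: _).
rewrite -[RHS]mulN1r -exprS -[LHS]signr_odd -[RHS]signr_odd.
congr (_ ^+ _); rewrite /= !oddD /= !oddb.
by case: ltngtP ij => [||/val_inj ->]; rewrite ?eqxx // => _ _;
  case: (odd _); case: (odd _).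
Qed.

(** X_i itself is not affected by sign_twist i, so the twist cancels in the
    square: this is what turns xi_i^2 - xi_k^2 into a commutative polynomial. *)
Lemma model_xi_sqr i p : model_xi i (model_xi i p) = 'X_i ^+ 2 * p.
Proof.
apply: (@mpoly_linear_eq _ (model_xi i \o model_xi i)
  (fun p => 'X_i ^+ 2 * p)) => [||m /=].
- exact: model_xi_comp_linear.
- by move=> k q r; rewrite mulrDr scalerAr.
have modelZ k := linear_mapZ (model_xi_linear k).
rewrite model_xiX modelZ model_xiX scalerA -exprD mult_belowD ltnn addn0 addnn.
by rewrite -signr_odd odd_double scale1r mulrC !mpolyXD mulrA.
Qed.

Definition mpoly_of_skew (f : skew) : {mpoly F[n]} := pact model_xi f 1.

Let model_rel a b :
  skew_rel a b -> term_act model_xi a =1 term_act model_xi b.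
Proof. by case=> i j ij p /=; apply: model_xi_anti. Qed.

Lemma mpoly_of_skew1 : mpoly_of_skew 1 = 1.
Proof. exact: (pact1 model_xi_linear model_rel). Qed.

Lemma mpoly_of_skew_linear : linear mpoly_of_skew.
Proof.
move=> k f g; rewrite /mpoly_of_skew.
by rewrite (pactDl model_xi_linear model_rel)
  (pactZl model_xi_linear model_rel).
Qed.

Lemma mpoly_of_skewM i f :
  mpoly_of_skew (xi i * f) = model_xi i (mpoly_of_skew f).
Proof.
by rewrite /mpoly_of_skew (pactM model_xi_linear model_rel)
  (pact_gen model_xi_linear model_rel).
Qed.

Definition ordered_mono (m : 'X_{1.. n}) : skew :=
  \prod_(j <- enum 'I_n) xi j ^+ m j.

(** mpoly_of_skew is only a linear map.  Its inverse sends a monomial to the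
    ordered monomial with the same exponents. *)
Definition skew_of_mpoly (p : {mpoly F[n]}) : skew :=
  \sum_(m <- msupp p) p@_m *: ordered_mono m.

(** Summing over any larger set of monomials makes linearity provable: three
    polynomials can then share one index sequence. *)
Lemma skew_of_mpolyE s p : uniq s -> {subset msupp p <= s} ->
  skew_of_mpoly p = \sum_(m <- s) p@_m *: ordered_mono m.
Proof.
move=> Us sub; rewrite (bigID (mem (msupp p))) /= [X in _ + X]big1; last first.
  by move=> m /memN_msupp_eq0 ->; rewrite scale0r.
rewrite addr0 -big_filter; apply/perm_big/uniq_perm; rewrite ?filter_uniq //.
by move=> m; rewrite mem_filter /=; case: (boolP (m \in _)) => // /sub ->.
Qed.

Lemma skew_of_mpoly_linear : linear skew_of_mpoly.
Proof.
move=> k p q; pose s := undup (msupp (k *: p + q) ++ msupp p ++ msupp q).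
have Us : uniq s by exact: undup_uniq.
rewrite !(@skew_of_mpolyE s) //; last first.
- by move=> m; rewrite mem_undup !mem_cat => ->.
- by move=> m; rewrite mem_undup !mem_cat => ->; rewrite orbT.
- by move=> m; rewrite mem_undup !mem_cat => ->; rewrite !orbT.
rewrite scaler_sumr -big_split /=; apply: eq_bigr => m _.
by rewrite mcoeffD mcoeffZ scalerDl scalerA.
Qed.

Lemma skew_of_mpolyX m : skew_of_mpoly (mono m) = ordered_mono m.
Proof. by rewrite /skew_of_mpoly msuppX big_seq1 mcoeffX eqxx scale1r. Qed.

Lemma sxi_expr_anti i j e :
  i != j -> xi i * xi j ^+ e = (-1) ^+ e *: (xi j ^+ e * xi i).
Proof.
move=> ij; elim: e => [|e IH]; first by rewrite !expr0 mulr1 mul1r scale1r.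
rewrite [sxi F j ^+ _ in LHS]exprS mulrA (sxi_anti F ij).
rewrite mulNr -[in LHS]mulrA. rewrite IH -pscalerAr mulrA.
by rewrite !exprS mulN1r scaleNr.
Qed.

Lemma sxi_prod_anti i (m : 'X_{1.. n}) (s : seq 'I_n) : i \notin s ->
  xi i * (\prod_(j <- s) xi j ^+ m j) =
  (-1) ^+ (\sum_(j <- s) m j) *: ((\prod_(j <- s) xi j ^+ m j) * xi i).
Proof.
elim: s => [|j s IH]; first by rewrite !big_nil mulr1 mul1r scale1r.
rewrite inE negb_or => /andP[ij /IH{}IH]; rewrite !big_cons mulrA.
rewrite sxi_expr_anti //.
rewrite -pscalerAl -[in LHS]mulrA IH -pscalerAr scalerA -exprD.
by rewrite mulrA.
Qed.

Lemma enum_ord_split (i : 'I_n) : exists s1 s2 : seq 'I_n,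
  [/\ enum 'I_n = s1 ++ i :: s2, all (fun j : 'I_n => (j < i)%N) s1
    & all (fun j : 'I_n => (i < j)%N) s2].
Proof.
have: pairwise (fun j k : 'I_n => (j < k)%N) (enum 'I_n).
  rewrite -(pairwise_map val ltn) val_enum_ord.
  rewrite -sorted_pairwise ?iota_ltn_sorted //.
  exact: ltn_trans.
case/splitPr: (mem_enum 'I_n i) => s1 s2.
rewrite pairwise_cat /= allrel_consr -!andbA => /and5P[s1i _ _ s2i _].
by exists s1, s2.
Qed.

(** The counterpart of model_xiX: variables before xi_i in the ordered product
    anticommute with it, those after it are not crossed. *)
Lemma sxi_ordered_mono i m :
  xi i * ordered_mono m =
  (-1) ^+ mult_below i m *: ordered_mono (m + U_(i))%MM.
Proof.
have [s1 [s2 [def_e s1i s2i]]] := enum_ord_split i.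
have is1 : i \notin s1 by apply/negP => /(allP s1i); rewrite ltnn.
have is2 : i \notin s2 by apply/negP => /(allP s2i); rewrite ltnn.
have mono_eq s : i \notin s ->
    \prod_(j <- s) xi j ^+ (m + U_(i))%MM j = \prod_(j <- s) xi j ^+ m j.
  move=> i_s; apply: eq_big_seq => j js; rewrite mnmDE mnm1E.
  by case: eqP i_s => [->|]; rewrite ?js // addn0.
rewrite /ordered_mono def_e !big_cat !big_cons /= !mono_eq //.
rewrite mulrA sxi_prod_anti //.
rewrite -pscalerAl; congr (_ ^+ _ *: _).
  have ->: mult_below i m = (\sum_(j <- enum 'I_n | (j < i)%N) m j)%N.
    by rewrite big_enum_cond; apply: eq_bigl.
  rewrite def_e big_cat big_cons ltnn /= -[LHS]addn0.
  congr (_ + _)%N.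
    by rewrite big_seq [RHS]big_seq_cond; apply: eq_bigl => j;
      case: (boolP (j \in s1)) => // /(allP s1i) ->.
  rewrite big_seq_cond big1 // => j /andP[/(allP s2i) ij].
  by rewrite ltnNge ltnW.
by rewrite mnmDE mnm1E eqxx addn1 exprS !mulrA.
Qed.

Lemma skew_of_model_xi i p :
  skew_of_mpoly (model_xi i p) = xi i * skew_of_mpoly p.
Proof.
have lin := skew_of_mpoly_linear.
apply: (@mpoly_linear_eq _ (skew_of_mpoly \o model_xi i)
  (fun p => xi i * skew_of_mpoly p)) => [k q r|k q r|m /=].
- by rewrite /= model_xi_linear lin.
- by rewrite lin mulrDr pscalerAr.
by rewrite model_xiX (linear_mapZ lin) !skew_of_mpolyX sxi_ordered_mono.
Qed.

(** skew_of_mpoly intertwines model_xi with left multiplication by the xi_i, so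
    it undoes mpoly_of_skew on everything generated from 1.  In particular a
    skew polynomial is determined by its image in the commutative model. *)
Lemma mpoly_of_skewK : cancel mpoly_of_skew skew_of_mpoly.
Proof.
elim/skew_ind => [|k f g IHf IHg|i f IH].
- rewrite mpoly_of_skew1 -mpolyX0 skew_of_mpolyX /ordered_mono big1 // => j _.
  by rewrite mnm0E.
- by rewrite mpoly_of_skew_linear skew_of_mpoly_linear IHf IHg.
- by rewrite mpoly_of_skewM skew_of_model_xi IH.
Qed.

Lemma skew_scale1_inj : injective (fun c : F => c *: (1 : skew)).
Proof.
move=> c d /(congr1 mpoly_of_skew).
rewrite !(linear_mapZ mpoly_of_skew_linear) mpoly_of_skew1.
by move/(congr1 (mcoeff 0)); rewrite !mcoeffZ mcoeff1 eqxx !mulr1.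
Qed.

End MonomialBasis.

(** The element acts on commutative polynomials as multiplication by
    X_i^2 - X_k^2, in an integral domain. *)
Lemma sxi_sqrB_inj (F : idomainType) (n : nat) (i k : 'I_n) : i != k ->
  injective (fun f : skew_poly F n => (sxi F i ^+ 2 - sxi F k ^+ 2) * f).
Proof.
move=> ik f g /= /(congr1 (@mpoly_of_skew F n)).
have E (h : skew_poly F n) :
    @mpoly_of_skew F n ((sxi F i ^+ 2 - sxi F k ^+ 2) * h) =
    ('X_i ^+ 2 - 'X_k ^+ 2) * mpoly_of_skew h.
  rewrite !mulrBl !expr2 -!mulrA addrC -scaleN1r mpoly_of_skew_linear.
  by rewrite !mpoly_of_skewM !model_xi_sqr scaleN1r addrC !expr2 !mulrA.
rewrite !E => /mulfI fg; apply: (can_inj (@mpoly_of_skewK _ _)); apply: fg.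
(* X_i^2 - X_k^2 is nonzero because it takes the value 1 at the i-th unit
   point. *)
apply/eqP => /(congr1 (meval (fun j => (j == i)%:R))).
rewrite mevalB !rmorphXn /= !mevalXU eqxx eq_sym (negPf ik) meval0.
rewrite expr1n expr0n.
by rewrite subr0; apply/eqP/oner_neq0.
Qed.
(** * The numerators of the Dunkl quotients *)

Section SkewCommutingIdentities.

Variables (A : pzRingType) (a b c : A).

(** The three cases of the recursion for N_ik (xi_j f), with a = xi_i, b = xi_k
    and s, x, y standing for the images of f under the transposition, tau_i and
    tau_k: here j = i, then j = k, then j different from both (c = xi_j). *)
Lemma dunkl_num_mul_fst (s x y : A) : b * a = - (a * b) ->
  (a - b) * (b * s) - (a * (- a * x) - b * (a * y)) =
  - (a * ((a - b) * s - (a * x - b * y))) + (a ^+ 2 - b ^+ 2) * s.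
Proof.
move=> ba; rewrite !expr2 !(mulrBl, mulrBr, mulNr, mulrN, mulrA) ba.
rewrite !(opprD, opprK, mulNr, addrA).
by rewrite [RHS](ACl (1 * 5 * (2 * 6) * (3 * 4)))%AC /= addNr add0r addrA.
Qed.

Lemma dunkl_num_mul_snd (s x y : A) : b * a = - (a * b) ->
  (a - b) * (a * s) - (a * (b * x) - b * (- b * y)) =
  - (b * ((a - b) * s - (a * x - b * y))) + (a ^+ 2 - b ^+ 2) * s.
Proof.
move=> ba; rewrite !expr2 !(mulrBl, mulrBr, mulNr, mulrN, mulrA) ba.
rewrite !(opprD, opprK, mulNr, addrA).
by rewrite [RHS](ACl (5 * 1 * (3 * 4) * (2 * 6)))%AC /= subrr addr0 addrA.
Qed.

Lemma dunkl_num_mul_off (s x y : A) : a * c = - (c * a) -> b * c = - (c * b) ->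
  (a - b) * (c * s) - (a * (c * x) - b * (c * y)) =
  - (c * ((a - b) * s - (a * x - b * y))).
Proof.
move=> ac bc; rewrite !mulrA mulrBl ac bc !(mulrBl, mulrBr, mulNr, mulrA).
by rewrite !(opprD, opprK).
Qed.

End SkewCommutingIdentities.

Section SkewOperators.

Variables (F : comNzRingType) (n : nat).
Local Notation skew := (skew_poly F n).
Local Notation xi := (@sxi F n).

Lemma sperm_linear s : linear (@sperm F n s).
Proof.
move=> k f g; rewrite -(preprK f) -(preprK g) -pclassZ -pclassD.
by rewrite !spermE.
Qed.

Lemma sperm1 s : sperm s (1 : skew) = 1.
Proof. by rewrite -pclass1 spermE. Qed.

Lemma spermMxi s i f : sperm s (xi i * f) = xi (s i) * sperm s f.
Proof. by rewrite -(preprK f) -pclassM !spermE. Qed.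

Lemma sperm_id (f : skew) : sperm 1%g f = f.
Proof.
move: f; apply: skew_linear_eq => [|//||i f IH]; first exact: sperm_linear.
  exact: sperm1.
by rewrite spermMxi perm1 IH.
Qed.

Lemma sperm_comp s r (f : skew) : sperm s (sperm r f) = sperm (r * s)%g f.
Proof.
move: f; apply: skew_linear_eq => [k f g|||i f IH].
- by rewrite !sperm_linear.
- exact: sperm_linear.
- by rewrite !sperm1.
- by rewrite !spermMxi permM IH.
Qed.

Lemma sperm_tperm s i j (f : skew) :
  sperm s (sperm (tperm i j) f) = sperm (tperm (s i) (s j)) (sperm s f).
Proof. by rewrite !sperm_comp conjgC tpermJ. Qed.

Lemma stau_linear i : linear (@stau F n i).
Proof.
move=> k f g; rewrite -(preprK f) -(preprK g) -pclassZ -pclassD.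
by rewrite !stauE.
Qed.

Lemma stau1 i : stau i (1 : skew) = 1.
Proof. by rewrite -pclass1 stauE. Qed.

Lemma stauMxi i j f :
  stau i (xi j * f) = (if j == i then - xi j else xi j) * stau i f.
Proof. by rewrite -(preprK f) -pclassM !stauE. Qed.

Lemma partial_linear i : linear (@partial F n i).
Proof.
move=> k f g; rewrite -(preprK f) -(preprK g) -pclassZ -pclassD.
by rewrite !partialE.
Qed.

Lemma partial1 i : partial i (1 : skew) = 0.
Proof. by rewrite -pclass1 partialE. Qed.

Lemma partialMxi i j (f : skew) :
  partial i (xi j * f) = (if i == j then f else 0) - xi j * partial i f.
Proof.
rewrite -(preprK f) -pclassM !partialE /= /sparity /= mulNr eq_sym.
by case: eqP => _; rewrite ?(mul1r, mul0r).
Qed.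

Lemma sxi_sqr_comm i j : xi i ^+ 2 * xi j = xi j * xi i ^+ 2.
Proof.
rewrite expr2; have [->|ij] := eqVneq i j; first by rewrite mulrA.
rewrite -[LHS]mulrA (sxi_anti F ij) mulrN [in LHS]mulrA (sxi_anti F ij).
by rewrite mulNr opprK -mulrA.
Qed.

Lemma sxi_sqrB_comm i k j (g : skew) :
  (xi i ^+ 2 - xi k ^+ 2) * (xi j * g) = xi j * ((xi i ^+ 2 - xi k ^+ 2) * g).
Proof.
by rewrite !mulrA; congr (_ * g); rewrite mulrBl mulrBr !sxi_sqr_comm.
Qed.

Lemma dunkl_num_linear i k : linear (@dunkl_num F n i k).
Proof.
move=> c f g; rewrite /dunkl_num !sperm_linear !stau_linear.
rewrite !mulrDr -!pscalerAr 2!scalerBr.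
by rewrite [RHS]addrACA -opprD [X in _ = _ - X]addrACA -opprD.
Qed.

Lemma dunkl_num1 i k : dunkl_num i k (1 : skew) = 0.
Proof. by rewrite /dunkl_num sperm1 !stau1 !mulr1 subrr. Qed.

(** N_ik anticommutes with xi_j up to a multiple of xi_i^2 - xi_k^2.  With
    N_ik 1 = 0 this gives divisibility of all numerators, and the correction
    term is exactly what the algebra prescribes as the bracket of eta_i with
    xi_j. *)
Lemma dunkl_numMxi i k j (f : skew) : i != k ->
  dunkl_num i k (xi j * f) =
  - (xi j * dunkl_num i k f) + (xi i ^+ 2 - xi k ^+ 2) *
    (if (j == i) || (j == k) then sperm (tperm i k) f else 0).
Proof.
move=> ik; rewrite /dunkl_num spermMxi !stauMxi.
have ki : k != i by rewrite eq_sym.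
move: (sperm _ f) (stau i f) (stau k f) => s x y.
have [->|ji] := eqVneq j i; first rewrite tpermL (negPf ik) /=.
  exact/dunkl_num_mul_fst/sxi_anti.
have [->|jk] := eqVneq j k; first rewrite tpermR /=.
  exact/dunkl_num_mul_snd/sxi_anti.
rewrite tpermD 1?eq_sym //= mulr0 addr0.
by apply: dunkl_num_mul_off; apply: sxi_anti; rewrite eq_sym.
Qed.

End SkewOperators.

(** * The Dunkl operators satisfy the relations *)

Section DunklOperators.

Variables (F : idomainType) (n : nat) (t u : F).
Local Notation skew := (skew_poly F n).
Local Notation xi := (@sxi F n).

Local Notation quotient i k f :=
  (skew_div (dunkl_num i k f) (xi i ^+ 2 - xi k ^+ 2)).

Lemma dunkl_num_dvd i k (f : skew) : i != k ->
  exists g, (xi i ^+ 2 - xi k ^+ 2) * g = dunkl_num i k f.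
Proof.
move=> ik; elim/skew_ind: f => [|c f g [f' Df] [g' Dg]|j f [g Dg]].
- by exists 0; rewrite mulr0 dunkl_num1.
- by exists (c *: f' + g'); rewrite dunkl_num_linear mulrDr -pscalerAr Df Dg.
exists (- (xi j * g) +
  if (j == i) || (j == k) then sperm (tperm i k) f else 0).
rewrite dunkl_numMxi // mulrDr mulrN -Dg; congr (- _ + _).
exact: sxi_sqrB_comm.
Qed.

Lemma quotientK i k (f : skew) : i != k ->
  (xi i ^+ 2 - xi k ^+ 2) * quotient i k f = dunkl_num i k f.
Proof.
by move=> ik; apply: (classical_sets.xgetPex 0 (dunkl_num_dvd f ik)).
Qed.

Lemma quotientE i k (f g : skew) : i != k ->
  (xi i ^+ 2 - xi k ^+ 2) * g = dunkl_num i k f -> quotient i k f = g.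
Proof. by move=> ik Dg; apply: (sxi_sqrB_inj ik); rewrite /= quotientK. Qed.

Lemma quotient_linear i k c (f g : skew) : i != k ->
  quotient i k (c *: f + g) = c *: quotient i k f + quotient i k g.
Proof.
move=> ik; apply: quotientE => //.
by rewrite mulrDr -pscalerAr !quotientK // dunkl_num_linear.
Qed.

Lemma quotient1 i k : i != k -> quotient i k (1 : skew) = 0.
Proof. by move=> ik; apply: quotientE; rewrite // mulr0 dunkl_num1. Qed.

Lemma quotientMxi i k j (f : skew) : i != k ->
  quotient i k (xi j * f) = - (xi j * quotient i k f) +
    (if (j == i) || (j == k) then sperm (tperm i k) f else 0).
Proof.
move=> ik; apply: quotientE => //.
by rewrite dunkl_numMxi // mulrDr mulrN sxi_sqrB_comm quotientK.
Qed.

Lemma dunkl_linear i : linear (@dunkl F n t u i).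
Proof.
move=> c f g; rewrite /dunkl partial_linear.
under eq_bigr => k ki do rewrite quotient_linear 1?eq_sym //.
rewrite big_split /= -scaler_sumr !scalerDr !scalerA.
by rewrite [t * c]mulrC [u * c]mulrC addrACA.
Qed.

Lemma dunkl1 i : dunkl t u i (1 : skew) = 0.
Proof.
rewrite /dunkl partial1 scaler0 add0r big1 ?scaler0 // => k ki.
by rewrite quotient1 // eq_sym.
Qed.

(** The right-hand side of the relations for [eta_i, xi_j]_+, as an operator on
    skew polynomials. *)
Definition eta_xi_bracket (i j : 'I_n) (f : skew) : skew :=
  if i == j then t *: f + u *: \sum_(k < n | k != i) sperm (tperm k i) f
  else u *: sperm (tperm i j) f.

(** Dividing dunkl_numMxi by xi_i^2 - xi_k^2 and summing: when j = i every k
    contributes a transposition, otherwise only k = j does. *)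
Lemma dunklMxi i j (f : skew) :
  dunkl t u i (xi j * f) = - (xi j * dunkl t u i f) + eta_xi_bracket i j f.
Proof.
rewrite /dunkl partialMxi.
under eq_bigr => k ki do rewrite quotientMxi 1?eq_sym //.
rewrite big_split /= sumrN -mulr_sumr mulrDr -!pscalerAr !scalerDr !scalerN.
rewrite opprD [X in X + _ = _]addrC addrACA; congr (_ + _).
rewrite /eta_xi_bracket; case: eqP => [<-|/eqP ij] /=.
  by congr (_ + _ *: _); apply: eq_bigr => k _; rewrite tpermC.
rewrite scaler0 add0r; congr (_ *: _).
rewrite (bigD1 j) /= 1?eq_sym // eqxx big1 ?addr0 // => k /andP[_ kj].
by rewrite eq_sym (negPf kj).
Qed.

Lemma sperm_bracket s i j (f : skew) :
  sperm s (eta_xi_bracket i j f) = eta_xi_bracket (s i) (s j) (sperm s f).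
Proof.
have spl := @sperm_linear F n s.
rewrite /eta_xi_bracket (inj_eq perm_inj); case: eqP => _; last first.
  by rewrite (linear_mapZ spl) sperm_tperm.
rewrite (linear_mapD spl) !(linear_mapZ spl); congr (_ + _ *: _).
rewrite (big_morph _ (linear_mapD spl) (linear_map0 spl)).
rewrite [RHS](reindex_inj (@perm_inj _ s)) /=.
by apply: eq_big => [k|k _]; rewrite ?(inj_eq perm_inj) ?sperm_tperm.
Qed.

(** Both sides vanish on 1 and obey conjugate recursions, since conjugation by s
    carries the bracket of (i, j) to that of (s i, s j). *)
Lemma sperm_dunkl s i (f : skew) :
  sperm s (dunkl t u i f) = dunkl t u (s i) (sperm s f).
Proof.
have spl := @sperm_linear F n s.
move: f; apply: skew_linear_eq => [k f g|k f g||j f IH].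
- by rewrite dunkl_linear spl.
- by rewrite spl dunkl_linear.
- by rewrite dunkl1 sperm1 dunkl1 (linear_map0 spl).
rewrite spermMxi !dunklMxi (linear_mapD spl) (linear_mapN spl) spermMxi IH.
by rewrite sperm_bracket.
Qed.

Lemma dunkl_tperm i j k (f : skew) :
  dunkl t u i (sperm (tperm j k) f) =
  sperm (tperm j k) (dunkl t u (tperm j k i) f).
Proof. by rewrite sperm_dunkl tpermK. Qed.

(** The transposition of k and j, for k different from i, fixes i and so
    commutes with eta_i; only the term k = i of the bracket survives. *)
Lemma dunkl_bracket_diag i j (f : skew) : i != j ->
  dunkl t u i (eta_xi_bracket j j f) - eta_xi_bracket j j (dunkl t u i f) =
  u *: (sperm (tperm i j) (dunkl t u j f) - sperm (tperm i j) (dunkl t u i f)).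
Proof.
move=> ij; have dl := dunkl_linear i.
rewrite /eta_xi_bracket eqxx (linear_mapD dl) !(linear_mapZ dl).
rewrite opprD addrACA subrr add0r -scalerBr; congr (_ *: _).
rewrite (big_morph _ (linear_mapD dl) (linear_map0 dl)) -sumrB.
rewrite (bigD1 i) //= dunkl_tperm tpermL big1 ?addr0 // => k /andP[kj ki].
by rewrite dunkl_tperm tpermD ?subrr // eq_sym.
Qed.

(** The super Jacobi identity equates the commutator of [eta_i, eta_j]_+ with
    xi_k to this sum of two commutators.  If k is neither i nor j both vanish;
    otherwise they are opposite multiples of s_ij (eta_i - eta_j) f. *)
Lemma dunkl_bracket_cyclic i j k (f : skew) : i != j ->
  (dunkl t u i (eta_xi_bracket j k f) - eta_xi_bracket j k (dunkl t u i f)) +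
  (dunkl t u j (eta_xi_bracket i k f) - eta_xi_bracket i k (dunkl t u j f)) = 0.
Proof.
have offdiag a b c : a != b -> a != c -> b != c ->
    dunkl t u a (eta_xi_bracket b c f) = eta_xi_bracket b c (dunkl t u a f).
  move=> ab ac bc; rewrite /eta_xi_bracket (negPf bc).
  rewrite (linear_mapZ (dunkl_linear a)) dunkl_tperm tpermD //.
  - by rewrite eq_sym.
  - by rewrite eq_sym.
have diag a b : a != b ->
    (dunkl t u a (eta_xi_bracket b b f) - eta_xi_bracket b b (dunkl t u a f)) +
    (dunkl t u b (eta_xi_bracket a b f) - eta_xi_bracket a b (dunkl t u b f))
    = 0.
  move=> ab; rewrite dunkl_bracket_diag // /eta_xi_bracket (negPf ab).
  rewrite (linear_mapZ (dunkl_linear b)) dunkl_tperm tpermR -scalerBr -scalerDr.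
  by rewrite addrA subrK subrr scaler0.
move=> ij; have [->|ki] := eqVneq k i; first by rewrite addrC diag // eq_sym.
have [->|kj] := eqVneq k j; first exact: diag.
by rewrite !(offdiag i j k, offdiag j i k) ?subrr ?addr0 // eq_sym.
Qed.

(** The anticommutator kills 1 and commutes with all xi_k, hence is zero. *)
Lemma dunkl_anti i j (f : skew) : i != j ->
  dunkl t u i (dunkl t u j f) = - dunkl t u j (dunkl t u i f).
Proof.
move=> ij; apply/eqP; rewrite -addr_eq0; apply/eqP; move: f.
have cyc k f := dunkl_bracket_cyclic k f ij.
(* Only these four properties of the Dunkl operators matter; forgetting the
   rest keeps rewriting from unfolding them as sums. *)
move: (dunkl t u) dunkl_linear dunkl1 dunklMxi cyc => eta dl d1 dM cyc.
apply: (@skew_linear_eq _ _ _ _ (fun=> 0)) => [c f g|c f g||k f /= IH].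
- by rewrite !dl addrACA scalerDr.
- by rewrite scaler0 addr0.
- by rewrite !(d1, linear_map0 (dl _)) addr0.
rewrite !dM !(linear_mapD (dl _)) !(linear_mapN (dl _)) !dM !opprD !opprK.
rewrite [LHS](AC (3 * 3) ((1 * 4) * ((3 * 5) * (6 * 2))))%AC /=.
by rewrite -mulrDr IH mulr0 add0r cyc.
Qed.

End DunklOperators.
(** * The Dunkl representation *)

Section DunklRepresentation.

Variables (F : idomainType) (n : nat) (t u : F).
Local Notation skew := (skew_poly F n).
Local Notation daha := (odd_daha n t u).

Definition dunkl_rep_gen (x : daha_gen n) : skew -> skew :=
  match x with
  | GXi i => fun f => sxi F i * f
  | GEta i => dunkl t u i
  | GSigma s => sperm s
  end.

Lemma dunkl_rep_gen_linear x : linear (dunkl_rep_gen x).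
Proof.
case: x => [i|i|s] /=; first by move=> k f g; rewrite mulrDr pscalerAr.
- exact: dunkl_linear.
- exact: sperm_linear.
Qed.

Lemma dunkl_rep_rel a b : daha_rel t u a b ->
  term_act dunkl_rep_gen a =1 term_act dunkl_rep_gen b.
Proof.
case=> {a b} [|s r|i j ij|i j ij|s j|s j|i j ij|i] f /=.
- exact: sperm_id.
- exact: sperm_comp.
- exact: dunkl_anti.
- by rewrite !mulrA (sxi_anti F ij) mulNr.
- exact: spermMxi.
- exact: sperm_dunkl.
- by rewrite dunklMxi addrAC addNr add0r /eta_xi_bracket (negPf ij).
rewrite dunklMxi addrAC addNr add0r /eta_xi_bracket eqxx; congr (_ + _ *: _).
by rewrite (big_morph (term_act dunkl_rep_gen ^~ f) (id1 := 0) (op1 := +%R)).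
Qed.

Definition dunkl_rep (x : daha) : skew -> skew := pact dunkl_rep_gen x.

Lemma dunkl_rep_linear x : linear (dunkl_rep x).
Proof. exact/pact_linear/dunkl_rep_gen_linear. Qed.

Lemma dunkl_rep1 f : dunkl_rep 1 f = f.
Proof. exact: (pact1 dunkl_rep_gen_linear dunkl_rep_rel). Qed.

Lemma dunkl_repM x y f : dunkl_rep (x * y) f = dunkl_rep x (dunkl_rep y f).
Proof. exact: (pactM dunkl_rep_gen_linear dunkl_rep_rel). Qed.

Lemma dunkl_repD x y f : dunkl_rep (x + y) f = dunkl_rep x f + dunkl_rep y f.
Proof. exact: (pactDl dunkl_rep_gen_linear dunkl_rep_rel). Qed.

Lemma dunkl_repN x f : dunkl_rep (- x) f = - dunkl_rep x f.
Proof. exact: (pactNl dunkl_rep_gen_linear dunkl_rep_rel). Qed.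

Lemma dunkl_repZ k x f : dunkl_rep (k *: x) f = k *: dunkl_rep x f.
Proof. exact: (pactZl dunkl_rep_gen_linear dunkl_rep_rel). Qed.

Lemma dunkl_rep_xi i f : dunkl_rep (dxi t u i) f = sxi F i * f.
Proof. exact: (pact_gen dunkl_rep_gen_linear dunkl_rep_rel). Qed.

Lemma dunkl_rep_eta i f : dunkl_rep (deta t u i) f = dunkl t u i f.
Proof. exact: (pact_gen dunkl_rep_gen_linear dunkl_rep_rel). Qed.

Lemma dunkl_rep_sigma s f : dunkl_rep (dsigma t u s) f = sperm s f.
Proof. exact: (pact_gen dunkl_rep_gen_linear dunkl_rep_rel). Qed.

End DunklRepresentation.

(** * Existence of the trivial module *)

Section TrivialModule.

Variables (F : idomainType) (n : nat) (t u : F).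
Local Notation skew := (skew_poly F n).
Local Notation daha := (odd_daha n t u).

(** The eta_i annihilate 1 and the group fixes it, so the line spanned by 1 is
    stable under the subalgebra that they generate. *)
Lemma heta_rep1 (b : daha) : in_heta b ->
  exists c : F, dunkl_rep b 1 = c *: (1 : skew).
Proof.
move=> hb; apply: (hb (fun b => exists c : F, dunkl_rep b 1 = c *: (1 : skew))).
split => [|x y [c Dx] [d Dy]|x y [c Dx] [d Dy]|k x [c Dx]].
- by exists 1; rewrite dunkl_rep1 scale1r.
- by exists (c - d); rewrite dunkl_repD dunkl_repN Dx Dy scalerBl.
- exists (d * c); rewrite dunkl_repM Dy (linear_mapZ (dunkl_rep_linear x)) Dx.
  by rewrite scalerA.
- by exists (k * c); rewrite dunkl_repZ Dx scalerA.
- by move=> i; exists 0; rewrite dunkl_rep_eta dunkl1 scale0r.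
- by move=> s; exists 1; rewrite dunkl_rep_sigma sperm1 scale1r.
Qed.

Lemma heta_char_subproof (b : heta n t u) :
  exists c : F, dunkl_rep (heta_val b) 1 = c *: (1 : skew).
Proof. by apply: heta_rep1; case: b => b /= /boolp.asboolP. Qed.

(** The scalar is unique by skew_scale1_inj, so b -> heta_char b is a
    character; it realizes the prescription eta_i -> 0, s -> 1. *)
Definition heta_char (b : heta n t u) : F :=
  projT1 (boolp.cid (heta_char_subproof b)).

Lemma heta_charE b : dunkl_rep (heta_val b) 1 = heta_char b *: (1 : skew).
Proof. by rewrite /heta_char; case: boolp.cid. Qed.

Lemma heta_char_eq b c :
  dunkl_rep (heta_val b) 1 = c *: (1 : skew) -> heta_char b = c.
Proof. by rewrite heta_charE => /skew_scale1_inj. Qed.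

Lemma heta_char1 : heta_char 1 = 1.
Proof. by apply: heta_char_eq; rewrite dunkl_rep1 scale1r. Qed.

Lemma heta_charD : {morph heta_char : b c / b + c}.
Proof.
by move=> b c; apply: heta_char_eq; rewrite dunkl_repD !heta_charE scalerDl.
Qed.

Lemma heta_charM : {morph heta_char : b c / b * c}.
Proof.
move=> b c; apply: heta_char_eq; rewrite dunkl_repM heta_charE.
by rewrite (linear_mapZ (dunkl_rep_linear _)) heta_charE scalerA mulrC.
Qed.

Lemma heta_char_scalar c : heta_char (heta_scalar n t u c) = c.
Proof. by apply: heta_char_eq; rewrite dunkl_repZ dunkl_rep1. Qed.

Lemma heta_char_eta i : heta_char (heta_eta t u i) = 0.
Proof. by apply: heta_char_eq; rewrite dunkl_rep_eta dunkl1 scale0r. Qed.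

Lemma heta_char_sigma s : heta_char (heta_sigma t u s) = 1.
Proof. by apply: heta_char_eq; rewrite dunkl_rep_sigma sperm1 scale1r. Qed.

(** The parameters are recorded in the type because the action of the subalgebra
    that is put on F depends on them. *)
Definition trivial_module : Type := let _ := (n, t, u) in F.
HB.instance Definition _ := GRing.Zmodule.copy trivial_module F.

Definition trivial_scale (b : heta n t u) (v : trivial_module) :
    trivial_module :=
  heta_char b * v.

Fact trivial_scaleA b c v :
  trivial_scale b (trivial_scale c v) = trivial_scale (b * c) v.
Proof. by rewrite /trivial_scale heta_charM mulrA. Qed.

Fact trivial_scale1 : left_id 1 trivial_scale.
Proof. by move=> v; rewrite /trivial_scale heta_char1 mul1r. Qed.

Fact trivial_scaleDr : right_distributive trivial_scale +%R.
Proof. by move=> b v w; rewrite /trivial_scale mulrDr. Qed.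

Fact trivial_scaleDl v : {morph trivial_scale^~ v : b c / b + c}.
Proof. by move=> b c; rewrite /trivial_scale heta_charD mulrDl. Qed.

HB.instance Definition _ := GRing.Zmodule_isLmodule.Build (heta n t u)
  trivial_module trivial_scaleA trivial_scale1 trivial_scaleDr trivial_scaleDl.

Lemma trivial_moduleP :
  is_trivial_module (trivial_module : lmodType (heta n t u)).
Proof.
have scaleE b v : b *: v = heta_char b * v :> trivial_module by [].
split=> [|s v|i v].
- exists 1; first exact: oner_neq0.
  by move=> v; exists v; rewrite scaleE heta_char_scalar mulr1.
- by rewrite scaleE heta_char_sigma mul1r.
- by rewrite scaleE heta_char_eta mul0r.
Qed.

End TrivialModule.
(** * The induced module *)

Section InducedModule.

Variables (F : fieldType) (n : nat) (t u : F).
Local Notation skew := (skew_poly F n).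
Local Notation daha := (odd_daha n t u).
Local Notation hs := (heta_scalar n t u).

Lemma daha_scalar_mul c (x : daha) : (c *: (1 : daha)) * x = c *: x.
Proof. by rewrite -pscalerAl mul1r. Qed.

Lemma daha_scalar_comm c (x : daha) :
  x * (c *: (1 : daha)) = (c *: (1 : daha)) * x.
Proof. by rewrite daha_scalar_mul -pscalerAr mulr1. Qed.

Lemma heta_scalar_comm c (b : heta n t u) : b * hs c = hs c * b.
Proof. by apply: val_inj; apply: daha_scalar_comm. Qed.

Lemma heta_scalarM c d : hs (c * d) = hs c * hs d.
Proof.
by apply: val_inj; rewrite /= [RHS]daha_scalar_mul scalerA.
Qed.

Lemma heta_scalarD c d : hs (c + d) = hs c + hs d.
Proof. by apply: val_inj; rewrite /= scalerDl. Qed.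

Lemma heta_scalar1 : hs 1 = 1.
Proof. by apply: val_inj; rewrite /= scale1r. Qed.

Lemma heta_scalar0 : hs 0 = 0.
Proof. by apply: val_inj; rewrite /= scale0r. Qed.

Lemma xi_embed_linear : linear (@xi_embed F n t u).
Proof.
move=> k f g; rewrite -(preprK f) -(preprK g) -pclassZ -pclassD.
by rewrite !xi_embedE.
Qed.

Lemma xi_embed1 : xi_embed t u (1 : skew) = 1.
Proof. by rewrite -pclass1 xi_embedE. Qed.

Lemma xi_embedMxi i (f : skew) :
  xi_embed t u (sxi F i * f) = dxi t u i * xi_embed t u f.
Proof. by rewrite -(preprK f) -pclassM !xi_embedE. Qed.

Lemma dunkl_rep_embed (f : skew) : dunkl_rep (xi_embed t u f) 1 = f.
Proof.
elim/skew_ind: f => [|k f g IHf IHg|i f IH].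
- by rewrite xi_embed1 dunkl_rep1.
- by rewrite xi_embed_linear dunkl_repD dunkl_repZ IHf IHg.
- by rewrite xi_embedMxi dunkl_repM IH dunkl_rep_xi.
Qed.

Definition daha_bracket (i j : 'I_n) : daha :=
  if i == j then
    t *: (1 : daha) + u *: \sum_(k < n | k != i) dsigma t u (tperm k i)
  else u *: dsigma t u (tperm i j).

Lemma deta_dxi i j :
  deta t u i * dxi t u j = - (dxi t u j * deta t u i) + daha_bracket i j.
Proof.
apply/(canRL (addKr _)); rewrite addrC /daha_bracket -!pclassM -pclassD.
case: eqP => [<-|/eqP ij]; last by rewrite -pclassZ; apply/pclass_rel/RelEtaXi.
rewrite (pclass_rel (RelEtaXi_diag t u i)) pclassD !pclassZ; congr (_ + _ *: _).
by apply: (big_morph (pclass (daha_rel t u))) => // a b; apply: pclassD.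
Qed.

Variables (V : lmodType (heta n t u)) (v0 : V).
Hypotheses (V_trivial : is_trivial_module V) (v0_neq0 : v0 != 0).

Lemma trivial_coord_ex v : exists c, v = hs c *: v0.
Proof.
case: V_trivial => [[w0 _ span] _ _]; have [a Dv0] := span v0.
have a_neq0 : a != 0.
  by apply: contraNneq v0_neq0 => a0; rewrite Dv0 a0 heta_scalar0 scale0r.
have [c ->] := span v; exists (c / a).
by rewrite [in RHS]Dv0 scalerA -heta_scalarM divfK.
Qed.

Definition trivial_coord v : F := projT1 (boolp.cid (trivial_coord_ex v)).

Lemma trivial_coordE v : v = hs (trivial_coord v) *: v0.
Proof. by rewrite /trivial_coord; case: boolp.cid. Qed.

Lemma heta_scale_inj c d : hs c *: v0 = hs d *: v0 -> c = d.
Proof.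
move=> cd; apply/eqP; rewrite -subr_eq0; apply: contraNT v0_neq0 => cd0.
rewrite -[v0]scale1r -heta_scalar1 -(mulVf cd0) heta_scalarM -scalerA.
rewrite heta_scalarD scalerDl cd -scalerDl -heta_scalarD subrr heta_scalar0.
by rewrite scale0r scaler0.
Qed.

Lemma trivial_coord_eq v c : v = hs c *: v0 -> trivial_coord v = c.
Proof. by rewrite {1}(trivial_coordE v) => /heta_scale_inj. Qed.

(** The two scalars by which the subalgebra acts, on v0 and on the skew
    polynomial 1, agree because they agree on generators. *)
Lemma heta_act_trivial (b : heta n t u) : b *: v0 = hs (heta_char b) *: v0.
Proof.
case: V_trivial => _ Vs Ve.
pose P (x : daha) := exists2 b : heta n t u, heta_val b = x
  & b *: v0 = hs (heta_char b) *: v0.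
have Pb : P (heta_val b).
  have /boolp.asboolP inb := valP b; apply: (inb P).
  - split=> [|x y [c <- Dc] [d <- Dd]|x y [c <- Dc] [d <- Dd]|k x [c <- Dc]].
    + by exists 1; rewrite // heta_char1 heta_scalar1.
    + exists (c - d) => //.
      have -> : heta_char (c - d) = heta_char c - heta_char d.
        by apply: heta_char_eq; rewrite dunkl_repD dunkl_repN !heta_charE scalerBl.
      apply: (addIr (d *: v0)); rewrite -scalerDl subrK Dd -scalerDl.
      by rewrite -heta_scalarD subrK.
    + exists (c * d) => //; rewrite -scalerA Dd scalerA heta_scalar_comm.
      by rewrite -scalerA Dc scalerA -heta_scalarM heta_charM mulrC.
    + exists (hs k * c); first exact: daha_scalar_mul.
      by rewrite -scalerA Dc scalerA -heta_scalarM heta_charM heta_char_scalar.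
  - by move=> i; exists (heta_eta t u i);
      rewrite // Ve heta_char_eta heta_scalar0 scale0r.
  - by move=> s; exists (heta_sigma t u s);
      rewrite // Vs heta_char_sigma heta_scalar1 scale1r.
by have [c /val_inj ->] := Pb.
Qed.

Lemma trivial_coordD v w :
  trivial_coord (v + w) = trivial_coord v + trivial_coord w.
Proof.
by apply: trivial_coord_eq; rewrite heta_scalarD scalerDl -!trivial_coordE.
Qed.

Lemma trivial_coord_scale b v :
  trivial_coord (b *: v) = heta_char b * trivial_coord v.
Proof.
apply: trivial_coord_eq; rewrite {1}(trivial_coordE v) scalerA heta_scalar_comm.
by rewrite -scalerA heta_act_trivial scalerA -heta_scalarM mulrC.
Qed.

(** The left inverse a (x) (c v0) -> c (a 1) of the identification; it is
    compatible with moving the subalgebra across the tensor sign by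
    heta_charE and heta_act_trivial. *)
Fixpoint tens_eval (x : tens_term daha V) : skew :=
  match x with
  | TensPure a v => trivial_coord v *: dunkl_rep a 1
  | TensZero => 0
  | TensOpp x => - tens_eval x
  | TensAdd x y => tens_eval x + tens_eval y
  end.

Lemma tens_eval_eq x y :
  tens_eq (\val : {rmorphism heta n t u -> daha}) x y ->
  tens_eval x = tens_eval y.
Proof.
elim=> {x y} //=.
- by move=> x y z _ -> _ ->.
- by move=> x y _ ->.
- by move=> x y z w _ -> _ ->.
- by move=> x y z; rewrite addrA.
- by move=> x y; rewrite addrC.
- by move=> x; rewrite add0r.
- by move=> x; rewrite addNr.
- by move=> a b v; rewrite dunkl_repD scalerDr.
- by move=> a v w; rewrite trivial_coordD scalerDl.
move=> a b v; rewrite dunkl_repM heta_charE (linear_mapZ (dunkl_rep_linear _)).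
by rewrite scalerA trivial_coord_scale mulrC.
Qed.

Definition skew_of_induced (x : induced V) : skew := tens_eval (trepr x).

Local Notation phi := (skew_to_induced v0).

Lemma skew_to_inducedK : cancel phi skew_of_induced.
Proof.
move=> f; rewrite /skew_of_induced (tens_eval_eq (tens_eq_trepr _ _)) /=.
rewrite dunkl_rep_embed (@trivial_coord_eq _ 1) ?scale1r //.
by rewrite heta_scalar1 scale1r.
Qed.

Lemma skew_to_inducedD f g : phi (f + g) = phi f + phi g.
Proof. by rewrite /skew_to_induced (linear_mapD xi_embed_linear) tpureDl. Qed.

Lemma skew_to_inducedZ c f : phi (c *: f) = (c *: (1 : daha)) *: phi f.
Proof.
rewrite /skew_to_induced (linear_mapZ xi_embed_linear) scale_tpure.
by rewrite daha_scalar_mul.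
Qed.

Lemma skew_to_induced0 : phi 0 = 0.
Proof. by rewrite -(scale0r (0 : skew)) skew_to_inducedZ !scale0r. Qed.

Lemma skew_to_inducedMxi i f : phi (sxi F i * f) = dxi t u i *: phi f.
Proof. by rewrite /skew_to_induced xi_embedMxi scale_tpure. Qed.

Lemma heta_act_induced1 (b : heta n t u) :
  heta_val b *: phi 1 = tpure _ (1 : daha) (b *: v0).
Proof.
rewrite /skew_to_induced xi_embed1 scale_tpure mulr1 -[heta_val b]mul1r.
exact: tpure_balanced.
Qed.

Lemma skew_to_induced_sperm s f : phi (sperm s f) = dsigma t u s *: phi f.
Proof.
elim/skew_ind: f => [|k f g IHf IHg|i f IH].
- rewrite sperm1 -[dsigma t u s]/(heta_val (heta_sigma t u s)).
  rewrite heta_act_induced1; case: V_trivial => _ -> _.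
  by rewrite /skew_to_induced xi_embed1.
- rewrite sperm_linear !skew_to_inducedD !skew_to_inducedZ IHf IHg scalerDr.
  by rewrite !scalerA daha_scalar_comm.
- rewrite spermMxi !skew_to_inducedMxi IH !scalerA; congr (_ *: _).
  by rewrite -!pclassM; apply/esym/pclass_rel/RelWXi.
Qed.

Lemma skew_to_induced_bracket i j f :
  phi (eta_xi_bracket t u i j f) = daha_bracket i j *: phi f.
Proof.
rewrite /eta_xi_bracket /daha_bracket; case: eqP => _; last first.
  by rewrite skew_to_inducedZ skew_to_induced_sperm scalerA daha_scalar_mul.
rewrite skew_to_inducedD !skew_to_inducedZ scalerDl; congr (_ + _).
rewrite -(daha_scalar_mul u (\sum_(k < n | _) _)) -scalerA; congr (_ *: _).
rewrite (big_morph _ skew_to_inducedD skew_to_induced0) scaler_suml.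
by apply: eq_bigr => k _; rewrite skew_to_induced_sperm.
Qed.

(** On 1 both sides are 0, as eta_i acts on V by 0; and left multiplication by
    eta_i on the induced module satisfies the recursion dunklMxi thanks to
    deta_dxi. *)
Lemma skew_to_induced_dunkl i f : phi (dunkl t u i f) = deta t u i *: phi f.
Proof.
elim/skew_ind: f => [|k f g IHf IHg|j f IH].
- rewrite dunkl1 skew_to_induced0 -[deta t u i]/(heta_val (heta_eta t u i)).
  rewrite heta_act_induced1; case: V_trivial => _ _ ->.
  by apply: (addrI (tpure _ (1 : daha) (0 : V))); rewrite -tpureDr !addr0.
- rewrite dunkl_linear (skew_to_inducedD (k *: _) (dunkl _ _ _ _)).
  rewrite (skew_to_inducedD (k *: f)) !skew_to_inducedZ IHf IHg scalerDr.
  by rewrite !scalerA daha_scalar_comm.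
- rewrite dunklMxi skew_to_inducedD skew_to_inducedMxi scalerA.
  rewrite deta_dxi scalerDl.
  rewrite skew_to_induced_bracket; congr (_ + _).
  rewrite -scaleN1r skew_to_inducedZ skew_to_inducedMxi IH !scalerA scaleN1r.
  by rewrite mulN1r mulNr.
Qed.

(** The identification is a morphism of modules over the whole algebra.  Hence
    its image is a submodule; as it contains 1 (x) v0, it is everything. *)
Lemma skew_to_induced_rep x f : phi (dunkl_rep x f) = x *: phi f.
Proof.
rewrite -{2}(preprK x); rewrite /dunkl_rep /pact.
elim: (prepr x) f => {x} [[i|i|s]||| a IH|a IHa b IHb|a IHa b IHb|k a IH] f /=.
- exact: skew_to_inducedMxi.
- exact: skew_to_induced_dunkl.
- exact: skew_to_induced_sperm.
- by rewrite skew_to_induced0 (scale0r (phi f)).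
- by rewrite (scale1r (phi f)).
- by rewrite pclassN scaleNr -IH -scaleN1r skew_to_inducedZ !scaleN1r.
- by rewrite pclassD scalerDl skew_to_inducedD IHa IHb.
- by rewrite pclassM -scalerA IHa IHb.
- by rewrite pclassZ skew_to_inducedZ IH scalerA daha_scalar_mul.
Qed.

Lemma skew_to_induced_surj x : exists f, phi f = x.
Proof.
rewrite -(treprK x); elim: (trepr x) => {x} [a v||x [f Df]|x [f Df] y [g Dg]].
- exists (dunkl_rep (a * heta_val (hs (trivial_coord v))) 1).
  rewrite skew_to_induced_rep -scalerA heta_act_induced1 -trivial_coordE.
  by rewrite scale_tpure mulr1.
- by exists 0; rewrite skew_to_induced0.
- by exists (- f); rewrite -scaleN1r skew_to_inducedZ Df -toppE !scaleN1r.
- by exists (f + g); rewrite skew_to_inducedD Df Dg -taddE.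
Qed.

Lemma skew_to_induced_bij : bijective phi.
Proof.
exists skew_of_induced; first exact: skew_to_inducedK.
by move=> x; have [f <-] := skew_to_induced_surj x; rewrite skew_to_inducedK.
Qed.

Lemma skew_to_induced_identification : is_identification v0 phi.
Proof.
split.
- by split; [exact: skew_to_induced_bij|rewrite /skew_to_induced xi_embed1].
- exact: skew_to_inducedD.
- exact: skew_to_inducedZ.
- exact: skew_to_inducedMxi.
- exact: skew_to_induced_sperm.
Qed.

End InducedModule.

Theorem theorem5p10 (R : realType) (n : nat) (t u : R[i]) :
  (exists V : lmodType (heta n t u), is_trivial_module V) /\
  (forall i k : 'I_n, i != k -> forall f : skew_poly R[i] n,
     exists! g, (sxi _ i ^+ 2 - sxi _ k ^+ 2) * g = dunkl_num i k f) /\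
  (forall (V : lmodType (heta n t u)) (v0 : V),
     is_trivial_module V -> v0 != 0 ->
     is_identification v0 (skew_to_induced v0) /\
     forall (i : 'I_n) (f : skew_poly R[i] n),
       deta t u i *: skew_to_induced v0 f = skew_to_induced v0 (dunkl t u i f)).
Proof.
split; first by exists (trivial_module n t u); apply: trivial_moduleP.
split=> [i k ik f|V v0 V_trivial v0_neq0].
  have [g Dg] := dunkl_num_dvd f ik; exists g; split=> // g' Dg'.
  by apply: (sxi_sqrB_inj ik); rewrite /= Dg Dg'.
split=> [|i f]; first exact: skew_to_induced_identification.
exact/esym/skew_to_induced_dunkl.
Qed.
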